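(* Let $L$ be a strongly continuous domain. Then $\ll_s$ satisfies the interpolation property on $L$: for all $x,y\in L$, if $x\ll_s y$ then there exists $z\in L$ such that $x\ll_s z\ll_s y$.
   Context: A dcpo is a poset in which every directed subset (directed sets are nonempty) has a supremum. For $x\in L$ and $A\subseteq L$: $\uparrow x=\{y\in L: x\le y\}$, $\uparrow A=\bigcup_{a\in A}\uparrow a$; an upper set is a set $U$ with $U=\uparrow U$. Strong Scott topology: a subset $U\subseteq L$ is strongly Scott open if $U$ is an upper set and for every directed $D\subseteq L$ and every $x\in L$, $\bigcap_{d\in D}\uparrow d\cap\uparrow x\subseteq U$ implies $\uparrow d\cap\uparrow x\subseteq U$ for some $d\in D$. Let $\sigma^s(L)$ be the set of all strongly Scott open subsets. It is closed under binary intersections, and the strong Scott topology $\sigma_s(L)$ is the topology having $\sigma^s(L)$ as a base. A dcpo $L$ is a strongly continuous domain if for every $U\in\sigma_s(L)$ and $x\in U$ there is $u\in U$ with $x\in\mathrm{int}_{\sigma_s(L)}\uparrow u\subseteq\uparrow u\subseteq U$ (i.e. $(L,\sigma_s(L))$ is a C-space). Strong way-below relation: $x\ll_s y$ iff for every directed $D\subseteq L$ and every $a\in L$, $\bigcap_{d\in D}\uparrow d\cap\uparrow a\subseteq\uparrow y$ implies $\uparrow d\cap\uparrow a\subseteq\uparrow x$ for some $d\in D$. *)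

(* Defs.v *)
From HB Require Import structures.
From mathcomp Require Import all_boot all_order.
From mathcomp Require Import boolp classical_sets topology.

Set Implicit Arguments.
Unset Strict Implicit.
Unset Printing Implicit Defensive.

Import Order.TTheory.
Local Open Scope classical_set_scope.
Local Open Scope order_scope.

Section Posets.
Context (disp : Order.disp_t) (L : porderType disp).
Implicit Types (A D U : set L) (x y : L).

Definition up x : set L := [set y | x <= y].

Definition upset A : set L := \bigcup_(a in A) up a.

Definition is_upper_set U : Prop := U = upset U.

Definition directed D : Prop :=
  D !=set0 /\
  forall x y, D x -> D y -> exists z, [/\ D z, x <= z & y <= z].

Definition strongly_scott_open U : Prop :=
  is_upper_set U /\
  forall D x, directed D ->
    (\bigcap_(d in D) up d) `&` up x `<=` U ->
    exists2 d, D d & up d `&` up x `<=` U.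

Definition strong_way_below x y : Prop :=
  forall D a, directed D ->
    (\bigcap_(d in D) up d) `&` up a `<=` up y ->
    exists2 d, D d & up d `&` up a `<=` up x.

Lemma strongly_scott_openT : strongly_scott_open setT.
Proof.
split; last by move=> D x [[d Dd] _] _; exists d.
by rewrite /is_upper_set predeqE => y; split=> // _; exists y; rewrite /up /=.
Qed.

Lemma strongly_scott_openI (U V : set L) :
  strongly_scott_open U -> strongly_scott_open V ->
  strongly_scott_open (U `&` V).
Proof.
move=> [uU sU] [uV sV]; split.
  rewrite /is_upper_set predeqE => y; split=> [UVy|[a [Ua Va] ay]].
    by exists y; rewrite /up /=.
  by split; [rewrite uU; exists a | rewrite uV; exists a].
move=> D x dD; rewrite subsetI => -[DU DV].
have [d Dd dU] := sU D x dD DU; have [e De eV] := sV D x dD DV.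
have [z [Dz dz ez]] := dD.2 d e Dd De; exists z => // y [zy xy]; split.
  by apply: dU; split=> //; exact: le_trans dz zy.
by apply: eV; split=> //; exact: le_trans ez zy.
Qed.

End Posets.

Arguments directed {disp L} D.
Arguments strongly_scott_open {disp L} U.

Notation "x <<_s y" := (strong_way_below x y) (at level 70, no associativity).

Definition is_dcpo (disp : Order.disp_t) (L : porderType disp) : Prop :=
  forall D : set L, directed D -> exists s : L, isLub D s.

(* An alias of L, so that the strong Scott topology does not interfere with
   another topology L may carry. *)
Definition strong_scott (disp : Order.disp_t) (L : porderType disp) : Type := L.

Section StrongScottTopology.
Context (disp : Order.disp_t) (L : porderType disp).

HB.instance Definition _ := Choice.on (strong_scott L).

Let base_cover :
  \bigcup_(U in @strongly_scott_open disp L) id U = setT :> set (strong_scott L).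
Proof.
rewrite predeqE => x; split=> // _.
by exists setT => //; exact: strongly_scott_openT.
Qed.

Let base_join (U V : set L) (x : strong_scott L) :
  strongly_scott_open U -> strongly_scott_open V -> id U x -> id V x ->
  exists W : set L, [/\ strongly_scott_open W, id W x & id W `<=` id U `&` id V].
Proof.
by move=> oU oV Ux Vx; exists (U `&` V); split=> //; exact: strongly_scott_openI.
Qed.

HB.instance Definition _ :=
  isBaseTopological.Build (strong_scott L) base_cover base_join.

End StrongScottTopology.

Definition strongly_continuous_domain
    (disp : Order.disp_t) (L : porderType disp) : Prop :=
  is_dcpo L /\
  forall (U : set (strong_scott L)) (x : strong_scott L), open U -> U x ->
    exists u : strong_scott L,
      [/\ U u, interior (up u : set (strong_scott L)) x & up u `<=` U].

(* Main.v *)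
Require Import Defs.
From mathcomp Require Import all_boot all_order.
From mathcomp Require Import boolp classical_sets topology.

Import Order.TTheory.
Local Open Scope classical_set_scope.
Local Open Scope order_scope.

(** The crux is that in a strongly continuous domain the strong way-below
    relation is topological: [x <<_s y] holds exactly when [y] lies in the
    interior of [up x] for the strong Scott topology. Interpolation is then
    immediate from the C-space property: the open set [interior (up x)]
    contains [y], hence contains a point [u] such that [y] lies in
    [interior (up u)], and [x <<_s u], [u <<_s y] follow.

    That [y] in [interior (up x)] implies [x <<_s y] holds in every poset
    ([interior_up_swb]). For the converse one considers the set [W] of all [w]
    with [y] in [interior (up w)]. The C-space property makes [W] directed
    ([directed_interior_up]), and it puts every upper bound of [W] above [y]
    ([upper_bounds_interior_up]), because the complement of a principal ideal
    is strongly Scott open ([strongly_scott_open_not_le]). Feeding [W] to the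
    definition of [x <<_s y], together with an auxiliary point [a] that is
    itself taken in [W], gives [d] in [W] such that every common upper bound of
    [d] and [a] is above [x]; some [w] in [W] is such a bound, so [up w] is
    contained in [up x] and [y] is interior to [up x] ([swb_interior_up]). *)

Lemma strongly_scott_open_open (disp : Order.disp_t) (L : porderType disp)
    (U : set L) :
  strongly_scott_open U -> open (U : set (strong_scott L)).
Proof.
move=> oU; exists [set U]; first by move=> V /= ->.
by rewrite bigcup_set1.
Qed.

Lemma interior_strong_scottP (disp : Order.disp_t) (L : porderType disp)
    (A : set L) (y : L) :
  interior (A : set (strong_scott L)) y ->
  exists U : set L, [/\ strongly_scott_open U, U y & U `<=` A].
Proof.
rewrite /interior nbhsE => -[V [[B sB eV] Vy] VA].
move: Vy; rewrite -eV => -[U BU Uy]; exists U; split=> //.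
  exact: sB.
by move=> z Uz; apply: VA; rewrite -eV; exists U.
Qed.

(** This makes the specialization order of the strong Scott topology the given
    order. If [d] ranges over [D] and no common upper bound of [D] and [a] is
    below [b], then [b] itself is not such a bound, so [a] or a single [d]
    already fails to be below [b], and this failure passes to all larger
    elements. *)
Lemma strongly_scott_open_not_le (disp : Order.disp_t) (L : porderType disp)
    (b : L) :
  strongly_scott_open [set z : L | ~ z <= b].
Proof.
split.
  rewrite /is_upper_set predeqE => z; split=> [zb|[c /= cb cz] zb].
    by exists z => //; rewrite /up /=.
  by apply: cb; exact: le_trans cz zb.
move=> D a [[d0 Dd0] _] Db; case: (pselect (a <= b)) => [ab|nab]; last first.
  by exists d0 => // z [_ az] zb; apply: nab; exact: le_trans az zb.
have /existsNP [d /not_implyP [Dd ndb]] : ~ forall d, D d -> d <= b.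
  by move=> Dub; apply: (Db b).
by exists d => // z [dz _] zb; apply: ndb; exact: le_trans dz zb.
Qed.

(** A basic open set [U] with [y] in [U] and [U] inside [up x] contains [up y],
    hence the intersection in the definition of [x <<_s y]; strong Scott
    openness of [U] then provides the required element of the directed set. *)
Lemma interior_up_swb (disp : Order.disp_t) (L : porderType disp) (x y : L) :
  interior (up x : set (strong_scott L)) y -> x <<_s y.
Proof.
move=> /interior_strong_scottP [U [[uU sU] Uy Ux]] D a dD Da.
have [d Dd dU] : exists2 d, D d & up d `&` up a `<=` U.
  by apply: sU => // z /Da yz; rewrite uU; exists y.
by exists d => // z /dU /Ux.
Qed.

Lemma directed_interior_up (disp : Order.disp_t) (L : porderType disp)
    (hL : strongly_continuous_domain L) (y : L) :
  directed [set w : L | interior (up w : set (strong_scott L)) y].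
Proof.
split.
  by have [u [_ uy _]] := hL.2 setT y openT I; exists u.
move=> v w /= vy wy.
have [u [[uv uw] uy _]] := hL.2 _ y
  (openI (open_interior (up v : set (strong_scott L)))
         (open_interior (up w : set (strong_scott L)))) (conj vy wy).
by exists u; split => //; [exact: (interior_subset uv)
                         | exact: (interior_subset uw)].
Qed.

(** If an upper bound [b] were not above [y], the C-space property inside the
    open complement of the principal ideal of [b] would produce [u] not below
    [b] with [y] interior to [up u], contradicting that [b] is an upper bound. *)
Lemma upper_bounds_interior_up (disp : Order.disp_t) (L : porderType disp)
    (hL : strongly_continuous_domain L) (y : L) :
  \bigcap_(w in [set w : L | interior (up w : set (strong_scott L)) y]) up w
    `<=` up y.
Proof.
move=> b Wb; apply: contrapT => nyb.
have [u [nub uy _]] :=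
  hL.2 _ y (strongly_scott_open_open _ _ _ (strongly_scott_open_not_le _ _ b)) nyb.
by apply: nub; exact: Wb.
Qed.

(** The directed set of the points [w] with [y] interior to [up w] has [y] as a
    lower bound of its upper bounds, so [x <<_s y] applies to it. *)
Lemma swb_interior_up (disp : Order.disp_t) (L : porderType disp)
    (hL : strongly_continuous_domain L) (x y : L) :
  x <<_s y -> interior (up x : set (strong_scott L)) y.
Proof.
move=> xy; have dW := directed_interior_up _ _ hL y.
have [[a Wa] dirW] := dW.
(* [L] may lack a least element, so the second set [up a] cannot be made
   trivial; with [a] in the directed set itself it is harmless. *)
have [|d Wd dax] := xy _ a dW.
  by move=> z [Wz _]; exact: (upper_bounds_interior_up _ _ hL).
have [w [Ww dw aw]] := dirW _ _ Wd Wa.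
have xw : x <= w by exact: dax.
suff : up w `<=` up x by move=> /(@interiorS (strong_scott L)); exact.
by move=> z; exact: le_trans.
Qed.

Theorem proposition3p8 (disp : Order.disp_t) (L : porderType disp)
    (hL : strongly_continuous_domain L) (x y : L) :
  x <<_s y -> exists z : L, x <<_s z /\ z <<_s y.
Proof.
move=> /(swb_interior_up _ _ hL) xy.
have [u [xu uy _]] := hL.2 _ y (open_interior _) xy.
by exists u; split; exact: interior_up_swb.
Qed.
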